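(* Let $\sigma \in \mathfrak{S}_4$ and $\tau \in \overline{\mathbb{F}_q}$ with $\tau^N=\lambda$. \begin{enumerate} \item The isomorphism $h_\sigma^\tau := (\varphi_{\theta_0}^{\tau_\sigma})^{-1} \circ g_\sigma \circ \varphi_{\theta_0}^\tau \colon {}_2X_{2,\lambda}^\tau \to {}_2X_{2,\lambda_\sigma}^{\tau_\sigma}$ is given by \begin{align*} (x_1,x_2,y_1,y_2) \longmapsto & \sqrt[N]{d_{x_{\sigma}}} \Big( \big( \sqrt[N]{d_{x}}^{-1} (x_1,x_2,y_1,y_2)\big)*Q_\sigma\Big) = \dfrac{\sqrt[N]{d_{x_{\sigma}}}}{\sqrt[N]{d_{x}}* Q_\sigma} \Big( (x_1,x_2, y_1, y_2) * Q_\sigma \Big) . \end{align*} By the same correspondence, we have an isomorphism $$h_\sigma \colon {}_2X_{2,\lambda} \otimes \mathbb{F}_{q^N} \longrightarrow {}_2X_{2,\lambda_{\sigma}} \otimes \mathbb{F}_{q^N}.$$ \item For any $\sigma'\in \mathfrak{S}_4$, we have $h_{\sigma'}^{\tau_\sigma} \circ h_{\sigma}^\tau = h_{\sigma \sigma'}^\tau$. \item Put $d_\sigma := d_{x_\sigma}/ (d_x * Q_\sigma) \in G$. Define the automorphism $\pi_\sigma$ of $G\times \mathrm{Gal}$ by $(g, e) \mapsto ( K_{d_\sigma}(e)\,(g*Q_\sigma), e)$. Then, for $g \in G$ and $e \in \mathrm{Gal}$, $h_\sigma \circ (g,e) = \pi_\sigma(g, e) \circ h_\sigma$. \item For $\chi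 \in \widehat {G}$, we have $$ \chi(d_\sigma)\, N({}_2X_{2,\lambda}; \chi* {}^tQ_\sigma ) = N({}_2X_{2,\lambda_\sigma} ; \chi). $$ \end{enumerate}
   Context: Let $q$ be a power of a prime $p$, $\mathbb{F}_q$ the finite field with $q$ elements, $N=q-1$, and $\mathbb{F}_{q^N}$ the degree-$N$ extension of $\mathbb{F}_q$ in an algebraic closure; put $\mathrm{Gal}=\mathrm{Gal}(\mathbb{F}_{q^N}/\mathbb{F}_q)$ with Frobenius $F$. For each $a\in\mathbb{F}_q^*$ fix an $N$th root $\sqrt[N]{a}$ (with $\sqrt[N]{1}=1$), and let $K_a\colon \mathrm{Gal}\to\mu_N$, $e\mapsto e(\sqrt[N]{a})/\sqrt[N]{a}$; for tuples $a=(a_1,\dots,a_n)$ write $\sqrt[N]{a}=(\sqrt[N]{a_i})_i$, $K_a(e)=(K_{a_i}(e))_i$. For a tuple $x=(x_1,\dots,x_n)$ of nonzero entries (affine or homogeneous) and $A=(a_{ij})\in M(n,m;\mathbb{Z})$, $x*A := (\prod_i x_i^{a_{i1}},\dots,\prod_i x_i^{a_{im}})$; the same notation is used for tuples of characters; products/quotients of tuples are componentwise. For a variety $X$ over $\mathbb{F}_q$ with an action of a finite abelian group $G$ and $\chi\in\widehat G$, $N(X;\chi):=\frac{1}{\#G}\sum_{g\in G}\chi(g)\,\#\{P\in X(\overline{\mathbb{F}_q}) \mid \mathrm{Frob}(P)=g\cdot P\}$ (Frob the $q$-Frobenius). For $\lambda\in\mathbb{F}_q^*\setminus\{1\}$,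 ${}_2X_{2,\lambda}$ is the affine variety over $\mathbb{F}_q$ given by $x_i^N+y_i^N=1$ $(i=1,2)$, $\lambda x_1^Nx_2^N=y_1^Ny_2^N$, $x_1x_2y_1y_2\neq0$, with action of $G=(\mathbb{F}_q^* )^4$ by componentwise scaling of $(x_1,x_2,y_1,y_2)$; $G\times\mathrm{Gal}$ acts on ${}_2X_{2,\lambda}\otimes\mathbb{F}_{q^N}$. For $\tau^N=\lambda$, ${}_2X_{2,\lambda}^\tau:=\{(x_i,y_i)\in {}_2X_{2,\lambda}\otimes\mathbb{F}_{q^N} \mid \tau x_1x_2=y_1y_2\}$, so ${}_2X_{2,\lambda}\otimes\mathbb{F}_{q^N}=\bigsqcup_{\tau^N=\lambda}{}_2X_{2,\lambda}^\tau$. Fix $x=(x_{ij})\in GL_2(\mathbb{F}_q)$ with all $x_{ij}\neq0$ and $\lambda=\frac{x_{11}x_{22}}{x_{21}x_{12}}$; put $d_x=(x_{21},x_{12},x_{11},x_{22})$ and $z=(x\mid I_2)\in M(2,4;\mathbb{F}_q)$. For $\sigma\in\mathfrak{S}_4$ let $P_\sigma=(e_{\sigma(1)},\dots,e_{\sigma(4)})$ be the permutation matrix, write $(z^\sigma_{ij})=zP_\sigma$ and $\begin{pmatrix} z^\sigma_{13}& z^\sigma_{14}\\ z^\sigma_{23}&z^\sigma_{24}\end{pmatrix}^{-1}zP_\sigma=(x_\sigma\mid I_2)$ with $x_\sigma=(x^\sigma_{ij})\in GL_2(\mathbb{F}_q)$, and $\lambda_\sigma=\frac{x^\sigma_{11}x^\sigma_{22}}{x^\sigma_{21}x^\sigma_{12}}$.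 Let $X_x\subset\mathbb{P}^3$ be given by $u_1^N=x_{11}v_1^N+x_{21}v_2^N$, $u_2^N=x_{12}v_1^N+x_{22}v_2^N$, $u_1u_2v_1v_2\neq0$, and $g_\sigma\colon X_x\to X_{x_\sigma}$, $(u_1:u_2:v_1:v_2)\mapsto(u_1:u_2:v_1:v_2)*P_\sigma$. Let $\theta_0=\begin{pmatrix}-1&0&-1&0\\0&0&0&0\\0&0&1&0\\0&-1&0&0\end{pmatrix}$, $T$ the $4\times4$ integer matrix whose last column is ${}^t(1,1,-1,-1)$ and other entries $0$, $\theta=\theta_0+T$, $M=\begin{pmatrix}1&0&0&0\\0&1&0&0\\0&0&1&0\\-1&-1&-1&0\end{pmatrix}$, and $Q_\sigma=(\theta_0P_\sigma M+T)\theta^{-1}\in GL_4(\mathbb{Z})$. The isomorphism $\varphi^\tau_{\theta_0}\colon {}_2X^\tau_{2,\lambda}\to X_x\otimes\mathbb{F}_{q^N}$ is $(x_1,x_2,y_1,y_2)\mapsto(\sqrt[N]{d_x}^{-1}(x_1:x_2:y_1:y_2))*\theta_0=\big(\frac{\sqrt[N]{x_{21}}}{x_1}:\frac{\sqrt[N]{x_{22}}}{y_2}:\frac{\sqrt[N]{x_{21}}\,y_1}{\sqrt[N]{x_{11}}\,x_1}:1\big)$ (and similarly for $x_\sigma$). Finally $\tau_\sigma=\tau\cdot\frac{\sqrt[N]{d_x}*{}^t(1,1,-1,-1)}{\sqrt[N]{d_{x_\sigma}}*{}^t(1,1,-1,-1)}$, which satisfies $\tau_\sigma^N=\lambda_\sigma$.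 *)

(* Defs.v *)
From HB Require Import structures.
From mathcomp Require Import all_boot all_order all_algebra all_fingroup.
From mathcomp Require Import all_solvable all_field all_character.
From mathcomp Require Import finmap boolp classical_sets functions cardinality.
Set Implicit Arguments.
Unset Strict Implicit.
Unset Printing Implicit Defensive.

Import GRing.Theory.
Local Open Scope classical_set_scope.
Local Open Scope ring_scope.

(* Conventions.
   - Quadruples are indexed by 'I_4 = {0, 1, 2, 3}; a point (x1, x2, y1, y2)
     has coordinates P 0 = x1, P 1 = x2, P 2 = y1, P 3 = y2, and a homogeneous
     (u1 : u2 : v1 : v2) likewise.
   - Schemes are given by their functors of points on commutative rings. If X is
     a k-scheme and L / k an extension, the R-points of the k-scheme X (x) L are
     the pairs (P, phi) with phi : L -> R a ring morphism and P an R-point of X,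
     R being a k-algebra through phi; the L-scheme X (x) L is obtained by fixing
     phi. A condition "f <> 0" cutting out an open subscheme reads "f is a unit
     of R", which is f <> 0 when R is a field. *)

Notation quad R := {ffun 'I_4 -> R}.

Definition quad4 (T : Type) (a b c d : T) : quad T :=
  [ffun i => tnth [tuple a; b; c; d] i].

Definition qmul (R : comUnitRingType) (u v : quad R) : quad R :=
  [ffun i => u i * v i].

Definition qdiv (R : comUnitRingType) (u v : quad R) : quad R :=
  [ffun i => u i / v i].

Definition qinv (R : comUnitRingType) (u : quad R) : quad R :=
  [ffun i => (u i)^-1].

Definition qmap (T U : Type) (f : T -> U) (u : quad T) : quad U :=
  [ffun i => f (u i)].

Definition star (R : unitRingType) (n m : nat) (x : {ffun 'I_n -> R})
    (A : 'M[int]_(n, m)) : {ffun 'I_m -> R} :=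
  [ffun j => \prod_(i < n) x i ^ A i j].

Definition mx4 (s : seq (seq int)) : 'M[int]_4 :=
  \matrix_(i, j) nth 0 (nth [::] s i) j.

Definition wcol : 'cV[int]_4 := \col_i tnth [tuple 1; 1; -1; -1] i.

Definition theta0 : 'M[int]_4 :=
  mx4 [:: [:: -1;  0; -1; 0];
          [::  0;  0;  0; 0];
          [::  0;  0;  1; 0];
          [::  0; -1;  0; 0]].

Definition Tmx : 'M[int]_4 :=
  \matrix_(i, j) if j == 3 then wcol i 0 else 0.

Definition theta : 'M[int]_4 := theta0 + Tmx.

Definition Mmx : 'M[int]_4 :=
  mx4 [:: [::  1;  0;  0; 0];
          [::  0;  1;  0; 0];
          [::  0;  0;  1; 0];
          [:: -1; -1; -1; 0]].

(* The j-th column is the basis vector e_(s j): this is the transpose of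
   perm_mx s. *)
Definition Pmx (R : pzSemiRingType) (s : 'S_4) : 'M[R]_4 :=
  \matrix_(i, j) (i == s j)%:R.

Definition Qmx (s : 'S_4) : 'M[int]_4 :=
  (theta0 *m Pmx int s *m Mmx + Tmx) *m invmx theta.

Lemma theta_unit : theta \in unitmx.
Proof.
pose V : 'M[int]_4 := mx4 [:: [:: -1; 0; -1; 0]; [:: 0; -1; 0; -1];
                              [:: 0; 1; 1; 0]; [:: 0; 1; 0; 0]].
suff /mulmx1_unit[] : theta *m V = 1%:M by [].
apply/matrixP; do 2![case=> [[|[|[|[|//]]]] ?]]; apply/eqP;
  by rewrite !mxE !big_ord_recl big_ord0 !mxE.
Qed.

Section BaseField.

Variable k : finFieldType.

Definition Nq : nat := (#|k|).-1.

Definition lam (x : 'M[k]_2) : k := (x 0 0 * x 1 1) / (x 1 0 * x 0 1).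

Definition dvec (x : 'M[k]_2) : quad k :=
  quad4 (x 1 0) (x 0 1) (x 0 0) (x 1 1).

Definition zsig (x : 'M[k]_2) (s : 'S_4) : 'M[k]_(2, 2 + 2) :=
  row_mx x 1%:M *m (Pmx k s : 'M_(2 + 2)).

Definition xsig (x : 'M[k]_2) (s : 'S_4) : 'M[k]_2 :=
  lsubmx (invmx (rsubmx (zsig x s)) *m zsig x s).

(* R-points of 2X2,l for a k-algebra R with structure map a. *)
Definition X2 (R : comUnitRingType) (a : k -> R) (l : k) : set (quad R) :=
  [set P | [/\ P 0 ^+ Nq + P 2 ^+ Nq = 1,
               P 1 ^+ Nq + P 3 ^+ Nq = 1,
               a l * P 0 ^+ Nq * P 1 ^+ Nq = P 2 ^+ Nq * P 3 ^+ Nq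
             & P 0 * P 1 * P 2 * P 3 \is a GRing.unit]].

Definition Ggrp : finGroupType := {dffun forall i : 'I_4, {unit k}}.

Definition scale (R : comUnitRingType) (a : k -> R) (g : Ggrp) (P : quad R) :
    quad R :=
  [ffun i => a (val (g i)) * P i].

Definition gexpz (gT : finGroupType) (u : gT) (z : int) : gT :=
  (match z with Posz n => u ^+ n | Negz n => u ^- n.+1 end)%g.

Definition gstar (g : Ggrp) (A : 'M[int]_4) : Ggrp :=
  [ffun j => \prod_(i < 4) gexpz (g i) (A i j)]%g.

(* The value is a quotient of nonzero elements as soon as all the entries of x
   and of xsig x s are nonzero; the default 1 of insubd is then not used. *)
Definition dsig (x : 'M[k]_2) (s : 'S_4) : Ggrp :=
  [ffun i => insubd (1%g : {unit k})
     (qdiv (dvec (xsig x s)) (star (dvec x) (Qmx s)) i)].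

(* A character of G is a quadruple of characters of the unit group of k. *)
Notation chars := (quad 'CF([set: {unit k}]%G)).

Definition chi_eval (chi : chars) (g : Ggrp) : algC :=
  \prod_(i < 4) chi i (g i).

End BaseField.

Notation chars k := (quad 'CF([set: {unit k}]%G)).

(* N(X; chi) for a set X of geometric points with an action of a finite group
   G; the counted sets are finite in the intended use, where fset_set A is the
   finite set with the same elements as A. *)
Definition Nchi (G : finGroupType) (T : choiceType) (X : set T)
    (frob : T -> T) (act : G -> T -> T) (chi : G -> algC) : algC :=
  (#|G|%:R)^-1 *
  \sum_(g : G) chi g *
    (#|` fset_set [set P | X P /\ frob P = act g P]|%fset)%:R.

Section Extension.

Variables (k : finFieldType) (L : splittingFieldType k).

Notation Gal := (gal_of {:L}).

Definition kstruct (R : comUnitRingType) (phi : L -> R) : k -> R :=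
  fun a => phi a%:A.

(* rt is the chosen system of N-th roots of the elements of k. *)
Variable rt : k -> L.

Definition rtd (x : 'M[k]_2) : quad L := qmap rt (dvec x).

Definition tausig (x : 'M[k]_2) (tau : L) (s : 'S_4) : L :=
  tau * (star (rtd x) wcol 0 / star (rtd (xsig x s)) wcol 0).

(* K_a(e) = e(rt a) / rt a, an N-th root of unity, seen in the unit group of k;
   see KummerE. *)
Definition Kummer (a : k) (e : Gal) : {unit k} :=
  odflt 1%g [pick u : {unit k} | (val u)%:A == e (rt a) / rt a].

Definition Kummer4 (d : Ggrp k) (e : Gal) : Ggrp k :=
  [ffun i => Kummer (val (d i)) e].

Definition pisig (x : 'M[k]_2) (s : 'S_4) (ge : Ggrp k * Gal) :
    Ggrp k * Gal :=
  ((Kummer4 (dsig x s) ge.2 * gstar ge.1 (Qmx s))%g, ge.2).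

Section Points.

Variables (R : comUnitRingType) (phi : L -> R).

Definition X2L (l : k) : set (quad R) := X2 (kstruct phi) l.

Definition X2tau (l : k) (tau : L) : set (quad R) :=
  [set P | X2L l P /\ phi tau * P 0 * P 1 = P 2 * P 3].

(* An R-point of P^3 with invertible homogeneous coordinates, as the set of all
   its systems of homogeneous coordinates. *)
Definition projpt (u : quad R) : set (quad R) :=
  [set v | exists2 c : R, c \is a GRing.unit & v = [ffun i => c * u i]].

Definition Xproj (x : 'M[k]_2) : set (set (quad R)) :=
  [set U | exists2 u : quad R, U = projpt u &
     [/\ u 0 ^+ Nq k = kstruct phi (x 0 0) * u 2 ^+ Nq k +
                       kstruct phi (x 1 0) * u 3 ^+ Nq k,
         u 1 ^+ Nq k = kstruct phi (x 0 1) * u 2 ^+ Nq k +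
                       kstruct phi (x 1 1) * u 3 ^+ Nq k
       & u 0 * u 1 * u 2 * u 3 \is a GRing.unit]].

Definition gsig (s : 'S_4) (U : set (quad R)) : set (quad R) :=
  [set star u (Pmx int s) | u in U].

(* The formula does not involve tau, which only determines the domain. *)
Definition varphi (x : 'M[k]_2) (P : quad R) : set (quad R) :=
  projpt (star (qmul (qinv (qmap phi (rtd x))) P) theta0).

(* (varphi^(tau_s))^-1 o g_s o varphi^tau *)
Definition hsigtau (x : 'M[k]_2) (tau : L) (s : 'S_4) (P : quad R) : quad R :=
  'pinv_(fun=> [ffun=> 0])
    (X2tau (lam (xsig x s)) (tausig x tau s)) (varphi (xsig x s))
    (gsig s (varphi x P)).

Definition hsig (x : 'M[k]_2) (s : 'S_4) (P : quad R) : quad R :=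
  qmul (qmap phi (rtd (xsig x s)))
       (star (qmul (qinv (qmap phi (rtd x))) P) (Qmx s)).

End Points.

(* The automorphism (g, e) of the k-scheme X (x) L is g (x) Spec e: since Spec is
   contravariant, e sends an L-structure phi to phi o e. *)
Definition actL (R : comUnitRingType) (ge : Ggrp k * Gal)
    (Pphi : quad R * (L -> R)) : quad R * (L -> R) :=
  (scale (kstruct Pphi.2) ge.1 Pphi.1, Pphi.2 \o ge.2).

(* h_s as a morphism of k-schemes. *)
Definition hsigL (R : comUnitRingType) (x : 'M[k]_2) (s : 'S_4)
    (Pphi : quad R * (L -> R)) : quad R * (L -> R) :=
  (hsig Pphi.2 x s Pphi.1, Pphi.2).

(* f is an isomorphism of L-schemes from X to Y: bijective on R-points and
   natural in R. *)
Definition Liso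
    (X Y : forall R : comUnitRingType, (L -> R) -> set (quad R))
    (f : forall R : comUnitRingType, (L -> R) -> quad R -> quad R) : Prop :=
  (forall (R : comUnitRingType) (phi : {rmorphism L -> R}),
     set_bij (X R phi) (Y R phi) (f R phi)) /\
  (forall (R S : comUnitRingType) (phi : {rmorphism L -> R})
          (u : {rmorphism R -> S}) (P : quad R),
     X R phi P -> f S (u \o phi) (qmap u P) = qmap u (f R phi P)).

Lemma KummerE (a : k) (e : Gal) : a != 0 -> rt a ^+ Nq k = a%:A ->
  (val (Kummer a e))%:A = e (rt a) / rt a.
Proof.
move=> a0 rta; rewrite /Kummer; case: pickP => [u /eqP // | noU].
set c := _ / _ in noU.
have kA0 : a%:A != 0 :> L by rewrite scaler_eq0 (negPf a0) oner_eq0.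
have q_gt0 : (0 < #|k|)%N by apply/card_gt0P; exists 0.
have cN : c ^+ Nq k = 1.
  by rewrite expr_div_n -rmorphXn /= rta linearZ /= rmorph1 divff.
have /eqP : (map_poly (in_alg L) ('X^#|k| - 'X)).[c] = 0.
  by rewrite rmorphB /= map_polyXn map_polyX !hornerE -(prednK q_gt0) exprS
             cN mulr1 subrr.
rewrite finField_genPoly rmorph_prod horner_prod prodf_seq_eq0 /=.
case/hasP=> b _ /=; rewrite rmorphB /= map_polyX map_polyC !hornerE /= subr_eq0.
move=> /eqP cb.
have b0 : b != 0.
  apply: contra_eq_neq cN => b0; rewrite cb b0 scale0r expr0n.
  have : (1 < #|k|)%N by apply: finNzRing_gt1.
  by rewrite /Nq; case: #|k| => [|[|n]] //= _; rewrite eq_sym oner_eq0.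
have bU : b \is a GRing.unit by rewrite unitfE.
by have := noU (FinRing.unit k bU); rewrite /= -cb eqxx.
Qed.

End Extension.

(* Main.v *)
Require Import Defs.
From HB Require Import structures.
From mathcomp Require Import all_boot all_order all_algebra all_fingroup.
From mathcomp Require Import all_solvable all_field all_character.
From mathcomp Require Import finmap boolp classical_sets functions cardinality.
From mathcomp Require Import ring.
Set Implicit Arguments.
Unset Strict Implicit.
Unset Printing Implicit Defensive.
Import GRing.Theory.
Local Open Scope classical_set_scope.
Local Open Scope ring_scope.

(** Divide a point of 2X2 by the N-th roots of d_x, getting p. Then p * theta
    consists of the affine representative u = (u1 : u2 : v1 : 1) = p * theta0 of a
    point of X_x, completed by the N-th root of unity c = p * (1, 1, -1, -1),
    which is constant on each component 2X2^tau. Since theta is invertible over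
    the integers, p and (u, c) determine each other. In these coordinates Q_s
    permutes the homogeneous coordinates of u by s and fixes c; this gives the
    formula for h_s, its compatibility with composition, and its bijectivity, the
    inverse being the map attached to s^-1. The nondegeneracy of x (all 2 x 2
    minors of (x | 1) are nonzero) is stable under x |-> x_s. Finally h_s is, up to
    the constants rho = rt(d_(x_s)) / (rt(d_x) * Q_s), the monomial map of matrix
    Q_s, and rho^N = d_s lies in k: hence e(rho) / rho is the Kummer cocycle of
    d_s, and rho^q = d_s rho makes h_s carry the points with Frob P = g P to those
    with Frob P = d_s (g * Q_s) P. *)

(** * Monomial maps *)

Lemma forall_I4 (Q : 'I_4 -> Prop) : Q 0 -> Q 1 -> Q 2 -> Q 3 -> forall i, Q i.
Proof.
move=> Q0 Q1 Q2 Q3; case=> [[|[|[|[|//]]]] lti].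
- by rewrite (_ : Ordinal lti = 0) //; apply: val_inj.
- by rewrite (_ : Ordinal lti = 1) //; apply: val_inj.
- by rewrite (_ : Ordinal lti = 2) //; apply: val_inj.
- by rewrite (_ : Ordinal lti = 3) //; apply: val_inj.
Qed.

Lemma big_I4 (T : Type) (idx : T) (op : Monoid.law idx) (F : 'I_4 -> T) :
  \big[op/idx]_(i < 4) F i = op (F 0) (op (F 1) (op (F 2) (F 3))).
Proof.
rewrite !big_ord_recl big_ord0 Monoid.mulm1.
by do ![congr (op _ _)]; congr F; apply: val_inj.
Qed.

(** By convention the inverse of a non-unit is the element itself, so the laws for negative
    exponents are relied on only for tuples of units. *)
Definition tuple_unit (R : unitRingType) (n : nat) (u : {ffun 'I_n -> R}) :=
  forall i, u i \is a GRing.unit.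

Section Star.

Variable R : comUnitRingType.

Lemma exprzMl_unit (a b : R) (z : int) :
  a \is a GRing.unit -> b \is a GRing.unit -> (a * b) ^ z = a ^ z * b ^ z.
Proof. by move=> ua ub; rewrite exprMz_comm //; apply: mulrC. Qed.

Lemma prod_unit (I : finType) (F : I -> R) :
  (forall i, F i \is a GRing.unit) -> \prod_i F i \is a GRing.unit.
Proof. by move=> uF; apply: rpred_prod => i _; apply: uF. Qed.

Lemma exprz_prod (I : finType) (F : I -> R) (z : int) :
  (forall i, F i \is a GRing.unit) -> (\prod_i F i) ^ z = \prod_i F i ^ z.
Proof.
(* Invertibility of the partial products is carried through the induction, because multiplicativity
   of the power needs it. *)
move=> uF; suff [] : (\prod_i F i) ^ z = \prod_i F i ^ z /\
  \prod_i F i \is a GRing.unit by [].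
elim/big_rec2: _ => [|i y1 y2 _ [<- u2]]; first by rewrite exp1rz unitr1.
by rewrite exprzMl_unit // unitrM uF.
Qed.

Lemma exprz_sum (I : finType) (a : R) (f : I -> int) :
  a \is a GRing.unit -> a ^ (\sum_i f i) = \prod_i a ^ f i.
Proof.
by move=> ua; elim/big_rec2: _ => [|i y1 y2 _ <-]; rewrite ?expr0z ?exprzDr.
Qed.

Section Tuple.

Variable n : nat.
Implicit Types u v : {ffun 'I_n -> R}.

Lemma star_unit (m : nat) u (A : 'M[int]_(n, m)) :
  tuple_unit u -> tuple_unit (star u A).
Proof.
by move=> uu j; rewrite ffunE; apply: prod_unit => i; rewrite unitrXz.
Qed.

(** With [star1mx], this turns integer square matrices into a right action on tuples of units; a
    matrix invertible over the integers then acts bijectively. *)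
Lemma star_mulmx (m l : nat) u (A : 'M[int]_(n, m)) (B : 'M[int]_(m, l)) :
  tuple_unit u -> star (star u A) B = star u (A *m B).
Proof.
move=> uu; apply/ffunP => j; rewrite !ffunE.
under eq_bigr => i _.
  rewrite ffunE exprz_prod; last by move=> h; rewrite unitrXz.
  under eq_bigr do rewrite exprz_exp.
  over.
by rewrite exchange_big /=; apply: eq_bigr => i _; rewrite mxE exprz_sum.
Qed.

Lemma star1mx u : star u 1%:M = u.
Proof.
apply/ffunP => j; rewrite ffunE (bigD1 j) //= mxE eqxx expr1z big1 ?mulr1 //.
by move=> i /negPf nij; rewrite mxE nij expr0z.
Qed.

Lemma starD (m : nat) u (A B : 'M[int]_(n, m)) j :
  tuple_unit u -> star u (A + B) j = star u A j * star u B j.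
Proof.
move=> uu; rewrite !ffunE -big_split /=; apply: eq_bigr => i _.
by rewrite mxE exprzDr.
Qed.

End Tuple.

Implicit Types u v p : quad R.

Lemma qmul_unit u v : tuple_unit u -> tuple_unit v -> tuple_unit (qmul u v).
Proof. by move=> uu uv i; rewrite ffunE unitrM uu uv. Qed.

Lemma qinv_unit u : tuple_unit u -> tuple_unit (qinv u).
Proof. by move=> uu i; rewrite ffunE unitrV. Qed.

Lemma star_qmul u v (A : 'M[int]_4) : tuple_unit u -> tuple_unit v ->
  star (qmul u v) A = qmul (star u A) (star v A).
Proof.
move=> uu uv; apply/ffunP => j; rewrite !ffunE -big_split /=.
by apply: eq_bigr => i _; rewrite ffunE exprzMl_unit.
Qed.

Lemma star_qinv u (A : 'M[int]_4) : tuple_unit u ->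
  star (qinv u) A = qinv (star u A).
Proof.
move=> uu; apply/ffunP => j; rewrite !ffunE -exprN1 exprz_prod; last first.
  by move=> i; rewrite unitrXz.
by apply: eq_bigr => i _; rewrite ffunE exprz_inv exprz_exp mulrN1.
Qed.

Lemma qmulKV u v : tuple_unit u -> qmul u (qmul (qinv u) v) = v.
Proof. by move=> uu; apply/ffunP => i; rewrite !ffunE mulVKr. Qed.

Lemma qmulVK u v : tuple_unit u -> qmul (qinv u) (qmul u v) = v.
Proof. by move=> uu; apply/ffunP => i; rewrite !ffunE mulKr. Qed.

Lemma star_Pmx u (s : 'S_4) j : star u (Pmx int s) j = u (s j).
Proof.
rewrite ffunE (bigD1 (s j)) //= mxE eqxx expr1z big1 ?mulr1 // => i /negPf nij.
by rewrite mxE nij expr0z.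
Qed.

(** [Mmx] is thus the choice of the homogeneous representative with last coordinate 1. *)
Lemma star_Mmx u j : tuple_unit u -> star u Mmx j = u j / u 3.
Proof.
move=> uu; rewrite ffunE big_I4 /= !mxE /=; move: j; apply: forall_I4 => /=;
  by rewrite ?expr0z ?expr1z ?mul1r ?mulr1 ?mulrV // exprN1.
Qed.

(** Row 1 of [theta0] is zero, so [p 1] is lost here; it is recovered from [star p wcol 0]. *)
Lemma star_theta0 p : tuple_unit p ->
  [/\ star p theta0 0 = (p 0)^-1, star p theta0 1 = (p 3)^-1,
      star p theta0 2 = p 2 / p 0 & star p theta0 3 = 1].
Proof.
by move=> up; split; rewrite ffunE big_I4 /= !mxE /=
  ?expr0z ?expr1z ?mul1r ?mulr1 ?exprN1 // mulrC.
Qed.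

Lemma star_wcol p : tuple_unit p -> star p wcol 0 = p 0 * p 1 / (p 2 * p 3).
Proof.
move=> up; rewrite ffunE big_I4 /= !mxE /= ?expr1z ?exprN1.
by rewrite invrM // !mulrA -!mulrA [(p 3)^-1 * _]mulrC.
Qed.

Lemma star_Tmx p j : star p Tmx j = if j == 3 then star p wcol 0 else 1.
Proof.
rewrite ffunE; under eq_bigr do rewrite mxE.
by case: ifP => _; rewrite ?ffunE // big1.
Qed.

(** The last column of [theta0] is zero and [Tmx] has no other nonzero column, so the two summands
    do not mix. *)
Lemma star_theta p j : tuple_unit p ->
  star p theta j = if j == 3 then star p wcol 0 else star p theta0 j.
Proof.
move=> up; rewrite starD // star_Tmx; case: (star_theta0 up) => _ _ _ E3.
by case: eqP => [->|_]; rewrite ?E3 ?mul1r ?mulr1.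
Qed.

Lemma star_theta_inj p p' : tuple_unit p -> tuple_unit p' ->
  star p theta0 = star p' theta0 -> star p wcol 0 = star p' wcol 0 -> p = p'.
Proof.
move=> up up' E0 Ew; have E : star p theta = star p' theta.
  by apply/ffunP => j; rewrite !star_theta // E0 Ew.
have := congr1 (fun u => star u (invmx theta)) E.
by rewrite !star_mulmx // mulmxV ?theta_unit // !star1mx.
Qed.

(** By construction [Qmx s *m theta] is [theta0 *m Pmx int s *m Mmx + Tmx]: its first summand
    permutes the homogeneous coordinates and renormalizes the last one to 1, its second one keeps
    the invariant given by [wcol]. *)
Lemma star_Qmx_theta p s j : tuple_unit p ->
  star (star p (Qmx s)) theta j =
    if j == 3 then star p wcol 0 else star p theta0 (s j) / star p theta0 (s 3).
Proof.
move=> up; rewrite star_mulmx // /Qmx mulmxKV ?theta_unit // starD //.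
have u0 := star_unit theta0 up; have uP := star_unit (Pmx int s) u0.
rewrite -mulmxA -!star_mulmx // star_Mmx // !star_Pmx star_Tmx.
by case: eqP => [->|_]; rewrite ?mulr1 // mulrV ?mul1r.
Qed.

Lemma star_Qmx_theta0 p s j : tuple_unit p ->
  star (star p (Qmx s)) theta0 j = star p theta0 (s j) / star p theta0 (s 3).
Proof.
move=> up; have uq : tuple_unit (star p (Qmx s)) by apply: star_unit.
have := star_Qmx_theta s j up; rewrite star_theta //; case: eqP => // -> _.
case: (star_theta0 uq) => _ _ _ ->; rewrite mulrV //; exact: star_unit.
Qed.

Lemma star_Qmx_wcol p s : tuple_unit p ->
  star (star p (Qmx s)) wcol 0 = star p wcol 0.
Proof.
move=> up; have := star_Qmx_theta s 3 up; rewrite star_theta //.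
exact: star_unit.
Qed.

(** It suffices to compare homogeneous coordinates and the [wcol] invariant; the normalizing
    denominator of the first step cancels in the second. Products in ['S_4] apply the left factor
    first, hence the order. *)
Lemma star_QmxM p s s' : tuple_unit p ->
  star (star p (Qmx s)) (Qmx s') = star p (Qmx (s' * s)%g).
Proof.
move=> up; have uq := star_unit (Qmx s) up.
apply: star_theta_inj; do ?exact: star_unit; last by rewrite !star_Qmx_wcol.
apply/ffunP => j; rewrite !star_Qmx_theta0 // !permM.
have u0 := star_unit theta0 up.
by rewrite invrM ?unitrV // invrK mulrA mulrVK.
Qed.

Lemma star_Qmx1 p : tuple_unit p -> star p (Qmx 1) = p.
Proof.
move=> up; apply: star_theta_inj => //; last by rewrite star_Qmx_wcol.
  exact: star_unit.
apply/ffunP => j; rewrite star_Qmx_theta0 // !perm1.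
by case: (star_theta0 up) => _ _ _ ->; rewrite divr1.
Qed.

Lemma star_QmxK p s : tuple_unit p -> star (star p (Qmx s)) (Qmx s^-1) = p.
Proof. by move=> up; rewrite star_QmxM // mulVg star_Qmx1. Qed.

End Star.

Lemma qmap_unit (R S : unitRingType) (f : {rmorphism R -> S}) (u : quad R) :
  tuple_unit u -> tuple_unit (qmap f u).
Proof. by move=> uu i; rewrite ffunE rmorph_unit. Qed.

Lemma star_qmap (R S : unitRingType) (f : {rmorphism R -> S}) (m : nat)
    (u : quad R) (A : 'M[int]_(4, m)) j :
  tuple_unit u -> star (qmap f u) A j = f (star u A j).
Proof.
move=> uu; rewrite !ffunE rmorph_prod /=; apply: eq_bigr => i _.
by rewrite ffunE rmorphXz.
Qed.

(** * The matrices x_s *)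

Section Minors.

Variable k : fieldType.
Implicit Types (x : 'M[k]_2) (z : 'M[k]_(2, 4)).

Definition augmx x : 'M[k]_(2, 4) := row_mx x 1%:M.

Lemma augmxE x i : [/\ augmx x i 0 = x i 0, augmx x i 1 = x i 1,
  augmx x i 2 = (i == 0)%:R & augmx x i 3 = (i == 1)%:R].
Proof.
(* The columns of [row_mx] are indexed by ['I_(2 + 2)], so indices are matched through their
   values. *)
have E (j : 'I_4) (h : 'I_(2 + 2)) :
    j = h :> nat -> augmx x i j = row_mx x 1%:M i h.
  by move=> jh; congr (row_mx x 1%:M i _); apply: val_inj.
by split; [rewrite (E _ (lshift 2 0)) | rewrite (E _ (lshift 2 1))
  | rewrite (E _ (rshift 2 0)) | rewrite (E _ (rshift 2 1))];
  rewrite ?row_mxEl ?row_mxEr ?mxE.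
Qed.

(** For [z] of rank 2, these are the Plücker coordinates of its row space. *)
Definition minor2 z (i j : 'I_4) : k := z 0 i * z 1 j - z 0 j * z 1 i.

Lemma det2E x : \det x = x 0 0 * x 1 1 - x 0 1 * x 1 0.
Proof.
rewrite (expand_det_row _ 0) !big_ord_recl big_ord0 /cofactor !det_mx11 !mxE /=.
rewrite expr0 expr1 !mul1r addr0 mulN1r mulrN.
by congr (x _ _ * x _ _ - x _ _ * x _ _); apply: val_inj.
Qed.

(** Equivalent, by [minor2_neq0] and [nondeg_minor2], to a condition symmetric in the four columns
    of [augmx x]. *)
Definition nondeg x := x \in unitmx /\ forall i j, x i j != 0.

Lemma minor2_neq0 x (i j : 'I_4) :
  nondeg x -> i != j -> minor2 (augmx x) i j != 0.
Proof.
case; rewrite unitmxE unitfE det2E => det_n0 x_n0.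
have [E00 E01 E02 E03] := augmxE x 0; have [E10 E11 E12 E13] := augmxE x 1.
rewrite /minor2; move: j; apply: forall_I4; move: i; apply: forall_I4 => //= _;
  rewrite ?(E00, E01, E02, E03, E10, E11, E12, E13) /=
    ?(mulr0, mulr1, mul0r, mul1r, subr0, sub0r) ?oppr_eq0 ?oner_neq0 //.
(* The minor on columns 1, 0 is left: it is the opposite of the determinant. *)
by rewrite -oppr_eq0 opprB.
Qed.

Lemma nondeg_minor2 x :
  (forall i j : 'I_4, i != j -> minor2 (augmx x) i j != 0) -> nondeg x.
Proof.
move=> m_n0.
have [E00 E01 E02 E03] := augmxE x 0; have [E10 E11 E12 E13] := augmxE x 1.
(* Up to sign these five minors are the determinant and the four entries; the sixth one is 1. *)
have m01 := m_n0 0 1 isT; have m02 := m_n0 0 2 isT; have m03 := m_n0 0 3 isT.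
have m12 := m_n0 1 2 isT; have m13 := m_n0 1 3 isT.
move: m01 m02 m03 m12 m13; rewrite /minor2.
rewrite !(E00, E01, E02, E03, E10, E11, E12, E13) /=.
rewrite !(mulr0, mulr1, mul0r, mul1r, subr0, sub0r) !oppr_eq0.
move=> m01 x10 x00 x11 x01; split; first by rewrite unitmxE unitfE det2E.
case=> [[|[|//]] ?] [[|[|//]] ?].
- by move: x00; congr (x _ _ != 0); apply: val_inj.
- by move: x01; congr (x _ _ != 0); apply: val_inj.
- by move: x10; congr (x _ _ != 0); apply: val_inj.
- by move: x11; congr (x _ _ != 0); apply: val_inj.
Qed.

End Minors.

Section Xsig.

Variable k : finFieldType.
Implicit Types (x : 'M[k]_2) (s : 'S_4).

Lemma zsigE x s i j : zsig x s i j = augmx x i (s j).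
Proof.
rewrite /zsig mxE (bigD1 (s j)) //= [Pmx _ _ _ _]mxE eqxx mulr1 big1 ?addr0 //.
by move=> h /negPf nh; rewrite [Pmx _ _ _ _]mxE nh mulr0.
Qed.

Lemma rsubmx_zsigE x s i :
  rsubmx (zsig x s) i 0 = augmx x i (s 2) /\
  rsubmx (zsig x s) i 1 = augmx x i (s 3).
Proof.
by split; rewrite mxE zsigE; congr (augmx x i (s _)); apply: val_inj.
Qed.

Lemma rsubmx_zsig_unit x s : nondeg x -> rsubmx (zsig x s) \in unitmx.
Proof.
move=> gx; rewrite unitmxE unitfE det2E.
have [-> ->] := rsubmx_zsigE x s 0; have [-> ->] := rsubmx_zsigE x s 1.
by apply: minor2_neq0; rewrite // (inj_eq perm_inj).
Qed.

Lemma zsig_xsig x s : nondeg x ->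
  zsig x s = rsubmx (zsig x s) *m row_mx (xsig x s) 1%:M.
Proof.
move=> gx; have uA := rsubmx_zsig_unit s gx.
rewrite /xsig -{1}[zsig x s](mulKVmx uA); congr (_ *m _).
set A := rsubmx _ in uA *.
rewrite -[LHS]hsubmxK; congr row_mx.
by rewrite -[in X in _ *m X](hsubmxK (zsig x s)) -/A mul_mx_row row_mxKr mulVmx.
Qed.

(** A row space has at most one basis of the form [row_mx y 1%:M], so any factorization of this
    shape computes [xsig x s]. *)
Lemma xsig_uniq x s (A y : 'M[k]_2) :
  A \in unitmx -> zsig x s = A *m row_mx y 1%:M -> xsig x s = y.
Proof.
move=> uA E; rewrite /xsig E mul_mx_row mulmx1 row_mxKr mul_mx_row.
by rewrite mulVmx // mulKmx // row_mxKl.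
Qed.

(** Left multiplications commute with column permutations: the two changes of basis multiply, and
    the permutation matrices compose to that of [s' * s]. *)
Lemma xsigM x s s' : nondeg x -> nondeg (xsig x s) ->
  xsig (xsig x s) s' = xsig x (s' * s)%g.
Proof.
move=> gx gxs; apply/esym.
apply: (@xsig_uniq _ _ (rsubmx (zsig x s) *m rsubmx (zsig (xsig x s) s'))).
  by rewrite unitmx_mul !rsubmx_zsig_unit.
rewrite -mulmxA -zsig_xsig // /zsig mulmxA -zsig_xsig // /zsig -mulmxA.
congr (_ *m _); apply/matrixP => i j; rewrite !mxE permM.
rewrite (bigD1 (s' j)) //= !mxE eqxx mulr1 big1 ?addr0 // => h /negPf nh.
by rewrite !mxE nh mulr0.
Qed.

Lemma xsig1 x : xsig x 1 = x.
Proof.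
apply: (@xsig_uniq _ _ 1%:M); first exact: unitmx1.
rewrite mul1mx; apply/matrixP => i j; rewrite zsigE perm1 //.
Qed.

(** Column [s j] is expanded in columns [s 2] and [s 3]; the coefficients form column [j] of
    [augmx (xsig x s)]. *)
Lemma augmx_xsig x s i j : nondeg x ->
  augmx x i (s j) = augmx x i (s 2) * augmx (xsig x s) 0 j +
                    augmx x i (s 3) * augmx (xsig x s) 1 j.
Proof.
move=> gx; rewrite -[LHS]zsigE (zsig_xsig s gx) mxE.
rewrite !big_ord_recl big_ord0 addr0.
have [<- <-] := rsubmx_zsigE x s i.
by congr (rsubmx _ _ _ * augmx _ _ _ + rsubmx _ _ _ * augmx _ _ _);
  apply: val_inj.
Qed.

(** Minors are multiplicative: each minor of [augmx x] on permuted columns is the minor on [s 2],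
    [s 3] times the corresponding minor of [augmx (xsig x s)]. *)
Lemma nondeg_xsig x s : nondeg x -> nondeg (xsig x s).
Proof.
move=> gx; apply: nondeg_minor2 => i j nij.
have : minor2 (augmx x) (s i) (s j) != 0.
  by apply: minor2_neq0; rewrite ?(inj_eq perm_inj).
apply: contra_neq; rewrite /minor2 => E0.
rewrite ![augmx x _ (s i)]augmx_xsig // ![augmx x _ (s j)]augmx_xsig //.
transitivity (minor2 (augmx x) (s 2) (s 3) * minor2 (augmx (xsig x s)) i j).
  by rewrite /minor2; ring.
by rewrite /minor2 E0 mulr0.
Qed.

Lemma xsigK x s : nondeg x -> xsig (xsig x s) s^-1 = x.
Proof. by move=> gx; rewrite xsigM ?mulVg ?xsig1 //; apply: nondeg_xsig. Qed.

Lemma dvec_unit x : nondeg x -> tuple_unit (dvec x).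
Proof.
by case=> _ x_n0; apply: forall_I4; rewrite ffunE unitfE (tnth_nth 0) /=.
Qed.

Lemma lam_wcol x : nondeg x -> lam x * star (dvec x) wcol 0 = 1.
Proof.
move=> gx; rewrite star_wcol; last exact: dvec_unit.
rewrite !ffunE !(tnth_nth 0) /= /lam; case: gx => _ x_n0.
by field; rewrite !x_n0.
Qed.

End Xsig.

(** * Normalized points *)

Lemma quad_unitP (R : comUnitRingType) (P : quad R) :
  reflect (tuple_unit P) (P 0 * P 1 * P 2 * P 3 \is a GRing.unit).
Proof.
rewrite !unitrM; apply: (iffP idP) => [/andP[/andP[/andP[? ?] ?] ?]|uP].
  exact: forall_I4.
by rewrite !uP.
Qed.

Section Normalized.

Variables (k : finFieldType) (R : comUnitRingType) (a : {rmorphism k -> R}).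
Implicit Types (x : 'M[k]_2) (s : 'S_4) (u p P D : quad R).

Local Notation N := (Nq k).

(** Besides the two equations of [Xproj] this includes the trivial cases [j = 2] and [j = 3], so
    that all four columns play the same part under a permutation. *)
Definition proj_eq x u := forall j,
  u j ^+ N = a (augmx x 0 j) * u 2 ^+ N + a (augmx x 1 j) * u 3 ^+ N.

Lemma proj_eqP x u : proj_eq x u <->
  u 0 ^+ N = a (x 0 0) * u 2 ^+ N + a (x 1 0) * u 3 ^+ N /\
  u 1 ^+ N = a (x 0 1) * u 2 ^+ N + a (x 1 1) * u 3 ^+ N.
Proof.
have [E00 E01 E02 E03] := augmxE x 0; have [E10 E11 E12 E13] := augmxE x 1.
split=> [eq_u | [e0 e1]].
  by split; [have := eq_u 0 | have := eq_u 1]; rewrite ?E00 ?E10 ?E01 ?E11.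
by apply: forall_I4; rewrite ?E00 ?E10 ?E01 ?E11 ?E02 ?E12 ?E03 ?E13 //=
  rmorph1 rmorph0 mul1r mul0r ?addr0 ?add0r.
Qed.

Lemma proj_eqZ x u c : proj_eq x u -> proj_eq x [ffun i => c * u i].
Proof. by move=> eq_u j; rewrite !ffunE !exprMn eq_u; ring. Qed.

Lemma proj_eq_perm x s u :
  nondeg x -> proj_eq x u -> proj_eq (xsig x s) [ffun j => u (s j)].
Proof.
move=> gx eq_u j; rewrite !ffunE [LHS]eq_u (eq_u (s 2)) (eq_u (s 3)).
rewrite (augmx_xsig s 0 j gx) (augmx_xsig s 1 j gx) !rmorphD !rmorphM /=.
ring.
Qed.

(* The equations of 2X2 after division of a point by the N-th roots of d_x. *)
Definition normalized x p :=
  [/\ tuple_unit p, star p wcol 0 ^+ N = 1,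
      a (x 1 0) * p 0 ^+ N + a (x 0 0) * p 2 ^+ N = 1
    & a (x 0 1) * p 1 ^+ N + a (x 1 1) * p 3 ^+ N = 1].

(** The first equations differ by the factor [p 0 ^+ N], the second ones by [p 3 ^+ N], once the
    condition on [wcol] has been used to eliminate [p 1 ^+ N]. *)
Lemma normalizedP x p : tuple_unit p -> star p wcol 0 ^+ N = 1 ->
  normalized x p <-> proj_eq x (star p theta0).
Proof.
move=> up wN; rewrite proj_eqP; have [-> -> -> ->] := star_theta0 up.
move: (wN); rewrite star_wcol // expr1n !mulr1 !exprMn !exprVn => wN'.
have [V0 V2 V3] : [/\ p 0 ^+ N * p 0 ^- N = 1, p 2 ^+ N * p 2 ^- N = 1
    & p 3 ^+ N * p 3 ^- N = 1] by rewrite !divrr ?unitrX.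
have {}wN' : p 1 ^+ N = p 2 ^+ N * p 3 ^+ N * p 0 ^- N.
  move: wN'; rewrite exprMn invrM ?unitrX // => e.
  (* The last factor is the N-th power of [star p wcol 0], hence 1. *)
  transitivity (p 0 ^- N * (p 2 ^+ N * p 3 ^+ N) *
    (p 0 ^+ N * p 1 ^+ N * (p 3 ^- N * p 2 ^- N))).
    move: V0 V2 V3; move: (_ ^- N) (_ ^- N) (_ ^- N) => i0 i3 i2 V0 V2 V3.
    by ring: V0 V2 V3.
  by rewrite e mulr1 mulrC.
rewrite /normalized wN'; move: V0 V2 V3 {wN'}.
(* Powers and their inverses become independent atoms, linked only by the relations [V0], [V2], [V3]
   handed to [ring]. *)
move: (p 0 ^- N) (p 2 ^- N) (p 3 ^- N) => i0 i2 i3.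
move: (p 0 ^+ N) (p 2 ^+ N) (p 3 ^+ N) => q0 q2 q3 V0 V2 V3.
split=> [[_ _ e1 e2] | [e1 e2]]; split=> //.
- by rewrite -[LHS]mulr1 -e1; ring: V0.
- by rewrite -[LHS]mulr1 -e2; ring: V3.
- by rewrite -V0 e1; ring: V0.
- by rewrite -V3 e2; ring: V3.
Qed.

(** Seen through [normalizedP], the action of [Qmx s] is a permutation of homogeneous coordinates
    followed by a rescaling, and both preserve the projective equations. *)
Lemma normalized_star x s p :
  nondeg x -> normalized x p -> normalized (xsig x s) (star p (Qmx s)).
Proof.
move=> gx np; have [up wN _ _] := np; have uq := star_unit (Qmx s) up.
apply/(normalizedP _ uq); first by rewrite star_Qmx_wcol.
move/(normalizedP x up wN): np => /(proj_eq_perm s gx).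
move=> /(proj_eqZ (star p theta0 (s 3))^-1); congr (proj_eq _ _).
by apply/ffunP => j; rewrite ffunE [X in _ * X]ffunE star_Qmx_theta0 // mulrC.
Qed.

(** Since [lam x * (x 1 0 * x 0 1)] equals [x 0 0 * x 1 1], the third equation of [X2] loses its
    coefficients and says that [star p wcol 0] is an N-th root of unity. *)
Lemma X2_normalized x D p : nondeg x -> tuple_unit D ->
  (forall i, D i ^+ N = a (dvec x i)) ->
  X2 a (lam x) (qmul D p) <-> normalized x p.
Proof.
move=> gx uD DN.
have E i : qmul D p i ^+ N = a (dvec x i) * p i ^+ N by rewrite ffunE exprMn DN.
rewrite /X2 /= !E [dvec x 0]ffunE [dvec x 1]ffunE [dvec x 2]ffunE.
rewrite [dvec x 3]ffunE !(tnth_nth 0) /=.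
have up_iff : qmul D p 0 * qmul D p 1 * qmul D p 2 * qmul D p 3 \is a GRing.unit
    <-> tuple_unit p.
  split=> [/quad_unitP uP | up]; last by apply/quad_unitP/qmul_unit.
  by rewrite -(qmulVK p uD); apply: qmul_unit => //; apply: qinv_unit.
have w_iff : tuple_unit p -> (star p wcol 0 ^+ N = 1 <->
    a (lam x) * (a (x 1 0) * p 0 ^+ N) * (a (x 0 1) * p 1 ^+ N) =
    a (x 0 0) * p 2 ^+ N * (a (x 1 1) * p 3 ^+ N)).
  have [_ x_n0] := gx => up.
  have ub i j : a (x i j) \is a GRing.unit by rewrite rmorph_unit ?unitfE.
  have -> : a (lam x) * (a (x 1 0) * p 0 ^+ N) * (a (x 0 1) * p 1 ^+ N) =
            a (x 0 0) * a (x 1 1) * (p 0 * p 1) ^+ N.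
    transitivity (a (lam x * (x 1 0 * x 0 1)) * (p 0 * p 1) ^+ N).
      by rewrite !rmorphM exprMn /=; ring.
    by rewrite /lam mulfVK ?mulf_neq0 // rmorphM.
  have -> : a (x 0 0) * p 2 ^+ N * (a (x 1 1) * p 3 ^+ N) =
            a (x 0 0) * a (x 1 1) * (p 2 * p 3) ^+ N by rewrite exprMn; ring.
  have u23 : (p 2 * p 3) ^+ N \is a GRing.unit by rewrite unitrX ?unitrM ?up.
  have ux : a (x 0 0) * a (x 1 1) \is a GRing.unit by rewrite unitrM !ub.
  rewrite star_wcol // expr_div_n.
  split=> [e | /(mulrI ux) ->]; last by rewrite divrr.
  by rewrite -[in LHS](mulrVK u23 ((p 0 * p 1) ^+ N)) e mul1r.
split=> [[e1 e2 e3 /up_iff up] | [up wN e1 e2]]; split=> //.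
- exact/w_iff.
- exact/w_iff.
- exact/up_iff.
Qed.

(** For a unit point [P], the equation cutting out a component reads [t * star P wcol 0 = 1], and
    [star] is multiplicative in [P]. *)
Lemma tau_normalized D p (t : R) : tuple_unit D -> tuple_unit p ->
  t * qmul D p 0 * qmul D p 1 = qmul D p 2 * qmul D p 3 <->
  t * star D wcol 0 * star p wcol 0 = 1.
Proof.
move=> uD up; rewrite !star_wcol // !ffunE.
have ud : D 2 * D 3 * (p 2 * p 3) \is a GRing.unit by rewrite !unitrM !uD !up.
have -> : t * (D 0 * D 1 / (D 2 * D 3)) * (p 0 * p 1 / (p 2 * p 3)) =
    t * (D 0 * D 1 * (p 0 * p 1)) / (D 2 * D 3 * (p 2 * p 3)).
  rewrite [in RHS]invrM ?unitrM ?uD ?up //.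
  by move: (_ ^-1) (_ ^-1) => i j; ring.
split=> [e | e].
  rewrite (_ : t * _ = D 2 * D 3 * (p 2 * p 3)) ?divrr //.
  by transitivity (t * (D 0 * p 0) * (D 1 * p 1)); [ring | rewrite e; ring].
transitivity (D 2 * D 3 * (p 2 * p 3)); last by ring.
rewrite -[RHS]mul1r -e mulrVK //; ring.
Qed.

Lemma star_theta_surj u (c : R) : tuple_unit u -> u 3 = 1 ->
  c \is a GRing.unit ->
  exists2 p, tuple_unit p & star p theta0 = u /\ star p wcol 0 = c.
Proof.
(* As [u 3 = 1] carries no information, its place is taken by [c], and [theta] is inverted on the
   result. *)
move=> uu u3 uc; pose v : quad R := [ffun j => if j == 3 then c else u j].
have uv : tuple_unit v by move=> j; rewrite ffunE; case: ifP.
have up := star_unit (invmx theta) uv; exists (star v (invmx theta)) => //.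
have Ev j : star (star v (invmx theta)) theta j = v j.
  by rewrite star_mulmx // mulVmx ?theta_unit // star1mx.
split; last by have := Ev 3; rewrite star_theta // [v 3]ffunE eqxx.
apply/ffunP => j; have := Ev j; rewrite star_theta // [v j]ffunE.
by case: eqP => [-> _|//]; have [_ _ _ ->] := star_theta0 up.
Qed.

End Normalized.

(** * Projective points and permutations of their coordinates *)

Section ProjectivePoints.

Variable R : comUnitRingType.
Implicit Types u v : quad R.

Lemma projpt_refl u : projpt u u.
Proof.
by exists 1; rewrite ?unitr1 //; apply/ffunP => i; rewrite ffunE mul1r.
Qed.

Lemma projptZ u (c : R) : c \is a GRing.unit ->
  projpt [ffun i => c * u i] = projpt u.
Proof.
move=> uc; rewrite /projpt eqEsubset; split=> v /= [d ud ->].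
  exists (d * c); first by rewrite unitrM ud.
  by apply/ffunP => i; rewrite !ffunE mulrA.
exists (d / c); first by rewrite unitrM ud unitrV.
by apply/ffunP => i; rewrite !ffunE mulrA mulrVK.
Qed.

Lemma gsig_projpt s u : gsig s (projpt u) = projpt [ffun j => u (s j)].
Proof.
rewrite /gsig eqEsubset; split=> v /=.
  case=> _ [c uc ->] <-; exists c => //; apply/ffunP => j.
  by rewrite star_Pmx !ffunE.
case=> c uc ->; exists [ffun i => c * u i]; first by exists c.
by apply/ffunP => j; rewrite star_Pmx !ffunE.
Qed.

End ProjectivePoints.

(** * The maps h_s *)

Lemma can_set_bij (T U : Type) (A : set T) (B : set U) (f : T -> U)
    (g : U -> T) :
  {homo f : y / A y >-> B y} -> {homo g : y / B y >-> A y} ->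
  (forall y, A y -> g (f y) = y) -> (forall y, B y -> f (g y) = y) ->
  set_bij A B f.
Proof.
move=> fAB gBA fK gK; split=> [|y1 y2 /set_mem A1 /set_mem A2 E|y By].
- exact: fAB.
- by rewrite -(fK _ A1) E fK.
- by exists (g y); [apply: gBA | apply: gK].
Qed.

Lemma set_bij_pinv (T U : Type) (d : U -> T) (A : set T) (B : set U)
    (f : T -> U) (y : T) (z : U) :
  set_bij A B f -> A y -> f y = z -> 'pinv_d A f z = y.
Proof. by case=> _ inj_f _ Ay <-; apply: pinvKV; rewrite ?inE. Qed.

Lemma Nq_gt0 (k : finFieldType) : (0 < Nq k)%N.
Proof. by have := finNzRing_gt1 k; rewrite /Nq; case: #|k| => [|[|n]]. Qed.

Section Extension.

Variables (k : finFieldType) (L : splittingFieldType k) (rt : k -> L).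
Hypothesis rtN : forall a : k, a != 0 -> rt a ^+ Nq k = a%:A.
Implicit Types (x : 'M[k]_2) (s : 'S_4) (t : L).

Lemma rtd_expn x i : nondeg x -> rtd rt x i ^+ Nq k = (dvec x i)%:A.
Proof. by move=> gx; rewrite ffunE rtN // -unitfE; apply: dvec_unit. Qed.

Lemma rtd_unit x : nondeg x -> tuple_unit (rtd rt x).
Proof.
move=> gx i; rewrite -(unitrX_pos _ (Nq_gt0 k)) rtd_expn // unitfE.
by rewrite scaler_eq0 oner_eq0 orbF -unitfE; apply: dvec_unit.
Qed.

(** This product is what identifies a component in normalized coordinates; [tausig] is the label
    that keeps it fixed when [x] is replaced by [xsig x s]. *)
Lemma tausig_wcol x t s : nondeg x ->
  tausig rt x t s * star (rtd rt (xsig x s)) wcol 0 = t * star (rtd rt x) wcol 0.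
Proof.
move=> gx; rewrite /tausig mulrA mulrVK //.
exact/star_unit/rtd_unit/nondeg_xsig.
Qed.

Lemma tausigM x t s s' : nondeg x ->
  tausig rt (xsig x s) (tausig rt x t s) s' = tausig rt x t (s' * s)%g.
Proof.
move=> gx; have gxs := nondeg_xsig s gx; rewrite /tausig -xsigM // -!mulrA.
congr (_ * (_ * _)); rewrite mulKr //; exact/star_unit/rtd_unit.
Qed.

Lemma tausig1 x t : nondeg x -> tausig rt x t 1 = t.
Proof.
by move=> gx; rewrite /tausig xsig1 mulrV ?mulr1 //; apply/star_unit/rtd_unit.
Qed.

(** Hence an N-th root of [lam x] times [star (rtd rt x) wcol 0] is an N-th root of unity. *)
Lemma lam_rtd_wcol x : nondeg x ->
  (lam x)%:A * star (rtd rt x) wcol 0 ^+ Nq k = 1.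
Proof.
move=> gx; rewrite !star_wcol; last exact: rtd_unit.
rewrite expr_div_n !exprMn !rtd_expn //.
rewrite -!/(in_alg L _) -!rmorphM -fmorphV -!rmorphM /= -star_wcol.
  by rewrite lam_wcol // scale1r.
exact: dvec_unit.
Qed.

Lemma tausig_expn x t s : nondeg x -> t ^+ Nq k = (lam x)%:A ->
  tausig rt x t s ^+ Nq k = (lam (xsig x s))%:A.
Proof.
move=> gx tN; have gxs := nondeg_xsig s gx.
have uw : star (rtd rt (xsig x s)) wcol 0 ^+ Nq k \is a GRing.unit.
  exact/unitrX/star_unit/rtd_unit.
by apply: (mulIr uw); rewrite -exprMn tausig_wcol // exprMn tN !lam_rtd_wcol.
Qed.

Section Points.

Variables (R : comUnitRingType) (phi : {rmorphism L -> R}).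
Implicit Types P p : quad R.

Local Notation D x := (qmap phi (rtd rt x)).

(** [kstruct phi] bundled as a ring morphism, as the results on [normalized] require. *)
Definition alg_struct : {rmorphism k -> R} := phi \o in_alg L.

Lemma qmap_rtd_unit x : nondeg x -> tuple_unit (D x).
Proof. by move=> gx; apply/qmap_unit/rtd_unit. Qed.

Lemma X2L_normalized x P : nondeg x ->
  X2L phi (lam x) P <-> normalized alg_struct x (qmul (qinv (D x)) P).
Proof.
move=> gx; have uD := qmap_rtd_unit gx; rewrite -{1}(qmulKV P uD).
apply: (X2_normalized (a := alg_struct)) => // i.
by rewrite ffunE -rmorphXn rtd_expn.
Qed.

Lemma X2L_unit l P : X2L phi l P -> tuple_unit P.
Proof. by case=> _ _ _ /quad_unitP. Qed.

Lemma X2tau_normalized x t P : nondeg x ->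
  X2tau phi (lam x) t P <-> normalized alg_struct x (qmul (qinv (D x)) P) /\
    phi t * star (D x) wcol 0 * star (qmul (qinv (D x)) P) wcol 0 = 1.
Proof.
move=> gx; have uD := qmap_rtd_unit gx; rewrite /X2tau /= X2L_normalized //.
split=> -[nP e]; split=> //; have [up _ _ _] := nP.
  by apply/(tau_normalized _ uD up); rewrite qmulKV.
by move/(tau_normalized _ uD up): e; rewrite qmulKV.
Qed.

(** In normalized coordinates the constants disappear and the map is purely monomial. *)
Lemma hsig_normalize x s P : nondeg x ->
  qmul (qinv (D (xsig x s))) (hsig rt phi x s P) =
  star (qmul (qinv (D x)) P) (Qmx s).
Proof. by move=> gx; rewrite /hsig qmulVK //; apply/qmap_rtd_unit/nondeg_xsig. Qed.

Lemma hsig_X2L x s P : nondeg x ->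
  X2L phi (lam x) P -> X2L phi (lam (xsig x s)) (hsig rt phi x s P).
Proof.
move=> gx; rewrite !X2L_normalized ?hsig_normalize //; last exact: nondeg_xsig.
exact: normalized_star.
Qed.

Lemma hsig_X2tau x t s P : nondeg x -> X2tau phi (lam x) t P ->
  X2tau phi (lam (xsig x s)) (tausig rt x t s) (hsig rt phi x s P).
Proof.
move=> gx; have gxs := nondeg_xsig s gx.
rewrite !X2tau_normalized ?hsig_normalize // => -[nP e].
split; first exact: normalized_star.
have [up _ _ _] := nP; rewrite star_Qmx_wcol // -e; congr (_ * _).
rewrite !star_qmap; [|exact: rtd_unit|exact: rtd_unit].
by rewrite -!rmorphM tausig_wcol.
Qed.

Lemma hsigM x s s' P : nondeg x -> tuple_unit P ->
  hsig rt phi (xsig x s) s' (hsig rt phi x s P) = hsig rt phi x (s' * s)%g P.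
Proof.
move=> gx uP; rewrite {1}/hsig hsig_normalize // star_QmxM ?xsigM //.
  exact: nondeg_xsig.
by apply: qmul_unit => //; apply/qinv_unit/qmap_rtd_unit.
Qed.

Lemma hsig1 x P : nondeg x -> tuple_unit P -> hsig rt phi x 1 P = P.
Proof.
move=> gx uP; have uD := qmap_rtd_unit gx; rewrite /hsig xsig1 star_Qmx1 ?qmulKV //.
by apply: qmul_unit => //; apply: qinv_unit.
Qed.

Lemma hsigK x s P : nondeg x -> tuple_unit P ->
  hsig rt phi (xsig x s) s^-1 (hsig rt phi x s P) = P.
Proof. by move=> gx uP; rewrite hsigM // mulVg hsig1. Qed.

Lemma hsigKV x s P : nondeg x -> tuple_unit P ->
  hsig rt phi x s (hsig rt phi (xsig x s) s^-1 P) = P.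
Proof.
move=> gx uP; have gxs := nondeg_xsig s gx.
by rewrite -{1}(xsigK s gx) hsigM // mulgV hsig1.
Qed.

Lemma hsig_bij x s : nondeg x ->
  set_bij (X2L phi (lam x)) (X2L phi (lam (xsig x s))) (hsig rt phi x s).
Proof.
move=> gx; have gxs := nondeg_xsig s gx.
apply: (@can_set_bij _ _ _ _ _ (hsig rt phi (xsig x s) s^-1)) =>
  [P|P|P XP|P XP].
- exact: hsig_X2L.
- by rewrite -{2}(xsigK s gx); apply: hsig_X2L.
- by apply: hsigK => //; apply: X2L_unit XP.
- by apply: hsigKV => //; apply: X2L_unit XP.
Qed.

Lemma hsig_tau_bij x t s : nondeg x ->
  set_bij (X2tau phi (lam x) t) (X2tau phi (lam (xsig x s)) (tausig rt x t s))
    (hsig rt phi x s).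
Proof.
move=> gx; have gxs := nondeg_xsig s gx.
apply: (@can_set_bij _ _ _ _ _ (hsig rt phi (xsig x s) s^-1)) =>
  [P|P|P [XP _]|P [XP _]].
- exact: hsig_X2tau.
(* The inverse map lands in the right component: the labels compose, and that of [s^-1 * s] is [t]
   again. *)
- have := @hsig_X2tau (xsig x s) (tausig rt x t s) s^-1%g P gxs.
  by rewrite xsigK // tausigM // mulVg tausig1.
- by apply: hsigK => //; apply: X2L_unit XP.
- by apply: hsigKV => //; apply: X2L_unit XP.
Qed.

Lemma XprojP x U : Xproj phi x U <->
  exists u, [/\ U = projpt u, proj_eq alg_struct x u & tuple_unit u].
Proof.
split=> [[u -> [e0 e1 /quad_unitP uu]] |
         [u [-> /proj_eqP[e0 e1] /quad_unitP uu]]].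
  by exists u; split=> //; apply/proj_eqP.
by exists u.
Qed.

(** On one component the [wcol] invariant is a fixed root of unity, so a point amounts to its
    [theta0] coordinates, that is, to a point of [Xproj] scaled to have last coordinate 1. *)
Lemma varphi_bij x t : nondeg x -> t ^+ Nq k = (lam x)%:A ->
  set_bij (X2tau phi (lam x) t) (Xproj phi x) (varphi rt phi x).
Proof.
move=> gx tN; have uD := qmap_rtd_unit gx.
(* By [X2tau_normalized], [c] is the inverse of the [wcol] invariant of every normalized point of
   the component. *)
pose c := phi t * star (D x) wcol 0.
have cN : c ^+ Nq k = 1.
  rewrite /c star_qmap -?rmorphM -?rmorphXn /=; last exact: rtd_unit.
  by rewrite exprMn tN lam_rtd_wcol // rmorph1.
have uc : c \is a GRing.unit.
  by rewrite -(unitrX_pos _ (Nq_gt0 k)) cN unitr1.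
split=> [P /= | P P' | U /XprojP].
- move=> /(X2tau_normalized _ _ gx)[nP _]; apply/XprojP.
  exists (star (qmul (qinv (D x)) P) theta0); have [up wN _ _] := nP.
  by split=> //; [apply/normalizedP | apply: star_unit].
- rewrite !inE => /(X2tau_normalized _ _ gx)[[up _ _ _] e].
  move=> /(X2tau_normalized _ _ gx)[[up' _ _ _] e'] E.
  have [d ud Ed] : projpt (star (qmul (qinv (D x)) P') theta0)
      (star (qmul (qinv (D x)) P) theta0).
    by rewrite -[X in X _]E; apply: projpt_refl.
  have [_ _ _ E3] := star_theta0 up; have [_ _ _ E3'] := star_theta0 up'.
  (* Both representatives have last coordinate 1, which forces the scalar to be 1. *)
  have d1 : d = 1 by move: E3; rewrite Ed ffunE E3' mulr1.
  rewrite -(qmulKV P uD) -(qmulKV P' uD); congr (qmul _ _).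
  apply: star_theta_inj => //; last by apply: (mulrI uc); rewrite e e'.
  by rewrite Ed d1; apply/ffunP => j; rewrite ffunE mul1r.
- case=> u [-> eq_u uu]; pose v : quad R := [ffun i => (u 3)^-1 * u i].
  have uv : tuple_unit v by move=> i; rewrite ffunE unitrM unitrV !uu.
  have [||p up [Ep Ew]] := @star_theta_surj R v c^-1 uv; rewrite ?unitrV //.
    by rewrite ffunE mulVr.
  exists (qmul (D x) p); last by rewrite /varphi qmulVK // Ep projptZ // unitrV.
  apply/X2tau_normalized; rewrite // qmulVK // Ew mulrV //; split=> //.
  apply/normalizedP; rewrite // ?Ew ?exprVn ?cN ?invr1 // Ep.
  exact: proj_eqZ.
Qed.

Lemma gsig_Xproj x s U : nondeg x ->
  Xproj phi x U -> Xproj phi (xsig x s) (gsig s U).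
Proof.
move=> gx /XprojP[u [-> eq_u uu]]; apply/XprojP; exists [ffun j => u (s j)].
by split; [exact: gsig_projpt | exact: proj_eq_perm | move=> i; rewrite ffunE].
Qed.

Lemma gsigK x s U : Xproj phi x U -> gsig s^-1 (gsig s U) = U.
Proof.
move=> /XprojP[u [-> _ _]]; rewrite !gsig_projpt; congr projpt.
by apply/ffunP => j; rewrite !ffunE permKV.
Qed.

Lemma gsig_bij x s : nondeg x ->
  set_bij (Xproj phi x) (Xproj phi (xsig x s)) (gsig s).
Proof.
move=> gx; have gxs := nondeg_xsig s gx.
apply: (@can_set_bij _ _ _ _ _ (gsig s^-1)) => [U|U|U XU|U XU].
- exact: gsig_Xproj.
- by rewrite -{2}(xsigK s gx); apply: gsig_Xproj.
- exact: gsigK XU.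
- by rewrite -{1}(invgK s); apply: gsigK XU.
Qed.

(** The two homogeneous representatives differ by the unit [u (s 3)], the coordinate that the
    permutation brings to the last place. *)
Lemma varphi_hsig x s P : nondeg x -> tuple_unit P ->
  varphi rt phi (xsig x s) (hsig rt phi x s P) = gsig s (varphi rt phi x P).
Proof.
move=> gx uP; rewrite /varphi hsig_normalize // gsig_projpt.
have up : tuple_unit (qmul (qinv (D x)) P).
  by apply: qmul_unit => //; apply/qinv_unit/qmap_rtd_unit.
set u := star (qmul _ _) theta0; have uu : tuple_unit u by apply: star_unit.
rewrite -[RHS](@projptZ _ _ (u (s 3))^-1) ?unitrV //; congr projpt.
apply/ffunP => j; rewrite star_Qmx_theta0 //.
by rewrite [RHS]ffunE [X in _ = _ * X]ffunE mulrC.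
Qed.

(** [varphi] is injective on the target component, so the partial inverse is found by exhibiting a
    preimage there; [varphi_hsig] supplies it. *)
Lemma hsigtauE x t s P : nondeg x -> t ^+ Nq k = (lam x)%:A ->
  X2tau phi (lam x) t P -> hsigtau rt phi x t s P = hsig rt phi x s P.
Proof.
move=> gx tN XP; have gxs := nondeg_xsig s gx.
apply: (@set_bij_pinv _ _ _ _ (Xproj phi (xsig x s))).
- exact/varphi_bij/tausig_expn.
- exact: hsig_X2tau.
- by apply: varphi_hsig => //; apply: X2L_unit XP.1.
Qed.

Lemma hsig_qdiv x s P : nondeg x -> tuple_unit P ->
  hsig rt phi x s P =
    qmul (qmap phi (qdiv (rtd rt (xsig x s)) (star (rtd rt x) (Qmx s))))
         (star P (Qmx s)).
Proof.
move=> gx uP; have uD := qmap_rtd_unit gx; have ur := rtd_unit gx.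
rewrite /hsig star_qmul ?star_qinv //; last exact: qinv_unit.
apply/ffunP => j; rewrite ffunE [RHS]ffunE [X in _ * X]ffunE mulrA.
congr (_ * _); rewrite [X in _ * X]ffunE star_qmap // [RHS]ffunE !ffunE.
by rewrite rmorphM rmorphV //; have := star_unit (Qmx s) ur j; rewrite ffunE.
Qed.

End Points.

Lemma hsig_natural (R S : comUnitRingType) (phi : {rmorphism L -> R})
    (u : {rmorphism R -> S}) x s (P : quad R) : nondeg x -> tuple_unit P ->
  hsig rt (u \o phi) x s (qmap u P) = qmap u (hsig rt phi x s P).
Proof.
move=> gx uP; have uuP := qmap_unit u uP.
rewrite (hsig_qdiv (u \o phi)) // hsig_qdiv //; apply/ffunP => j.
by rewrite ffunE star_qmap // [RHS]ffunE [in RHS]ffunE rmorphM /= !ffunE.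
Qed.

Lemma X2tau_qmap (R S : comUnitRingType) (phi : {rmorphism L -> R})
    (u : {rmorphism R -> S}) l t (P : quad R) :
  X2tau phi l t P -> X2tau (u \o phi) l t (qmap u P).
Proof.
case=> -[e1 e2 e3 uP] et; split.
  split; rewrite !ffunE -?rmorphXn -?rmorphD -?rmorphM ?e1 ?e2 ?rmorph1 //.
    by rewrite -e3 !rmorphM.
  exact: rmorph_unit.
by rewrite !ffunE -!(rmorphM u) /= et.
Qed.

End Extension.

(** * Galois action and point counts *)

Section RootsOfUnity.

Variables (k : finFieldType) (F : fieldType) (f : {rmorphism k -> F}).

(** Such a [c] is a root of the image of ['X^#|k| - 'X], which is the product of the ['X - b%:P]
    over all [b] in [k]. *)
Lemma root_unity_range (c : F) : c ^+ Nq k = 1 -> exists2 b, b != 0 & c = f b.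
Proof.
move=> cN; have q_gt0 : (0 < #|k|)%N by apply/card_gt0P; exists 0.
have /eqP : (map_poly f ('X^#|k| - 'X)).[c] = 0.
  by rewrite rmorphB /= map_polyXn map_polyX !hornerE -(prednK q_gt0) exprS
             cN mulr1 subrr.
rewrite finField_genPoly rmorph_prod horner_prod prodf_seq_eq0 /=.
case/hasP=> b _ /=; rewrite rmorphB /= map_polyX map_polyC !hornerE /= subr_eq0.
move=> /eqP cb; exists b => //; apply: contra_eq_neq cN => b0.
by rewrite cb b0 rmorph0 expr0n gtn_eqF ?Nq_gt0 // eq_sym oner_eq0.
Qed.

End RootsOfUnity.

Lemma star_expn (R : comUnitRingType) (u : quad R) (A : 'M[int]_4) (n : nat) j :
  star u A j ^+ n = star [ffun i => u i ^+ n] A j.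
Proof.
rewrite !ffunE -prodrXl; apply: eq_bigr => i _; rewrite ffunE.
by rewrite !exprnP !exprz_exp mulrC.
Qed.

(** * The group G, its monomial endomorphisms and its characters *)

Section UnitGroup.

Variable k : finFieldType.
Implicit Types g h : Ggrp k.

Definition gval g : quad k := [ffun i => val (g i)].

Lemma gval_inj : injective gval.
Proof.
move=> g h /ffunP E; apply/ffunP => i; apply: val_inj.
by have := E i; rewrite !ffunE.
Qed.

Lemma gval_unit g : tuple_unit (gval g).
Proof. by move=> i; rewrite ffunE; apply: (valP (g i)). Qed.

Lemma gvalM g h : gval (g * h)%g = qmul (gval g) (gval h).
Proof. by apply/ffunP => i; rewrite !ffunE. Qed.

Lemma val_gexpz (u : {unit k}) (z : int) : val (gexpz u z) = val u ^ z.
Proof. by case: z => n; rewrite /= ?FinRing.val_unitV FinRing.val_unitX. Qed.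

Lemma gval_gstar g (A : 'M[int]_4) : gval (gstar g A) = star (gval g) A.
Proof.
apply/ffunP => j; rewrite !ffunE (big_morph _ (@FinRing.val_unitM k) (erefl _)).
by apply: eq_bigr => i _; rewrite val_gexpz ffunE.
Qed.

Lemma gstarM (A : 'M[int]_4) : {morph (gstar (k:=k))^~ A : g h / (g * h)%g}.
Proof.
move=> g h; apply: gval_inj; rewrite gvalM !gval_gstar gvalM star_qmul //;
  exact: gval_unit.
Qed.

Lemma gstar_Qmx_inj s : injective ((gstar (k:=k))^~ (Qmx s)).
Proof.
move=> g h /(congr1 gval); rewrite !gval_gstar => E; apply: gval_inj.
have := congr1 (fun u => star u (Qmx s^-1)) E.
by rewrite !star_QmxK //; apply: gval_unit.
Qed.

Lemma gval_dsig (x : 'M[k]_2) s : nondeg x ->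
  gval (dsig x s) = qdiv (dvec (xsig x s)) (star (dvec x) (Qmx s)).
Proof.
move=> gx; apply/ffunP => i; rewrite ffunE [dsig x s i]ffunE insubdK //.
rewrite unfold_in -[X in is_true X]/(_ \is a GRing.unit) [qdiv _ _ _]ffunE.
rewrite unitrM unitrV; apply/andP; split.
  exact/dvec_unit/nondeg_xsig.
exact/star_unit/dvec_unit.
Qed.

Lemma scale_qmul (R : comUnitRingType) (a : k -> R) g (P : quad R) :
  scale a g P = qmul (qmap a (gval g)) P.
Proof. by apply/ffunP => i; rewrite !ffunE. Qed.

Lemma star_scale (R : comUnitRingType) (a : {rmorphism k -> R}) g (P : quad R)
    (A : 'M[int]_4) : tuple_unit P ->
  star (scale a g P) A = scale a (gstar g A) (star P A).
Proof.
move=> uP; have ug := gval_unit g; rewrite scale_qmul star_qmul //; last first.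
  exact: qmap_unit.
rewrite scale_qmul gval_gstar; congr (qmul _ _); apply/ffunP => j.
by rewrite star_qmap // [RHS]ffunE.
Qed.

Lemma scaleM (R : comUnitRingType) (a : {rmorphism k -> R}) g h (P : quad R) :
  scale a (g * h)%g P = scale a g (scale a h P).
Proof. by apply/ffunP => i; rewrite !ffunE rmorphM mulrA. Qed.

Lemma lin_char_gexpz (chi : 'CF([set: {unit k}]%G)) (u : {unit k}) (z : int) :
  chi \is a linear_char -> (chi ^ z) u = chi (gexpz u z).
Proof.
move=> chiL; have uT : u \in [set: {unit k}]%G by rewrite inE.
case: z => n /=; first by rewrite -exprnP exp_cfunE // lin_charX.
have unT : (u ^+ n.+1)%g \in [set: {unit k}]%G by rewrite inE.
(* The inverse of a linear character in the ring of class functions is its complex conjugate, whose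
   values are those at inverse elements. *)
rewrite NegzE -invr_expz -exprnP -exprVn exp_cfunE // invr_lin_char // cfunE.
by rewrite lin_charV // lin_charX // -exprVn -lin_charV // lin_charV_conj.
Qed.

Section Characters.

Variable chi : chars k.
Hypothesis chi_lin : forall i, chi i \is a linear_char.

Lemma chi_evalM g h : chi_eval chi (g * h)%g = chi_eval chi g * chi_eval chi h.
Proof.
rewrite /chi_eval -big_split /=; apply: eq_bigr => i _.
by rewrite ffunE lin_charM ?inE.
Qed.

(** Transposition is adjunction for the pairing of characters with group elements: the two products
    over the indices are exchanged. *)
Lemma chi_eval_star g (A : 'M[int]_4) :
  chi_eval (star chi A^T) g = chi_eval chi (gstar g A).
Proof.
rewrite /chi_eval.
under eq_bigr => j _.
  rewrite ffunE prod_cfunE ?inE //.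
  under eq_bigr => i _ do rewrite mxE lin_char_gexpz //.
  over.
rewrite exchange_big /=; apply: eq_bigr => i _; rewrite [gstar _ _ _]ffunE.
rewrite (big_morph (chi i) (id1 := 1) (op1 := *%R)) //; last exact: lin_char1.
by move=> u v; rewrite lin_charM ?inE.
Qed.

End Characters.

End UnitGroup.

(** * Equivariance under G and the Galois group *)

Section Equivariance.

Variables (k : finFieldType) (L : splittingFieldType k) (rt : k -> L).
Hypothesis rtN : forall a : k, a != 0 -> rt a ^+ Nq k = a%:A.
Implicit Types (x : 'M[k]_2) (s : 'S_4) (e : gal_of {:L}).

Lemma gal_alg e (b : k) : e (b%:A) = b%:A.
Proof. by rewrite linearZ /= rmorph1. Qed.

Lemma alg_neq0 (b : k) : (b%:A == 0 :> L) = (b == 0).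
Proof. by rewrite scaler_eq0 oner_eq0 orbF. Qed.

Lemma expn_alg_neq0 (b : k) (y : L) : b != 0 -> y ^+ Nq k = b%:A -> y != 0.
Proof.
move=> b0 yN; apply: contraNneq b0 => y0; move: yN.
by rewrite y0 expr0n gtn_eqF ?Nq_gt0 // => /esym/eqP; rewrite alg_neq0.
Qed.

(* The Kummer cocycle does not depend on the choice of the root, since the
   N-th roots of unity lie in k. *)
Lemma Kummer_root (b : k) (y : L) e : b != 0 -> y ^+ Nq k = b%:A ->
  (val (Kummer rt b e))%:A = e y / y.
Proof.
move=> b0 yN; rewrite KummerE ?rtN //.
have r0 := expn_alg_neq0 b0 (rtN b0); have y0 := expn_alg_neq0 b0 yN.
have [|c c0 Ec] := @root_unity_range k L (in_alg L) (y / rt b).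
  by rewrite expr_div_n yN rtN // divff // alg_neq0.
have -> : y = c%:A * rt b by rewrite -[c%:A]/(in_alg L c) -Ec mulfVK.
by rewrite rmorphM /= gal_alg -mulf_div divff ?mul1r // alg_neq0.
Qed.

(** The value of the cocycle at [e] lies in [k] and is fixed by [e'], so the cocycle is a
    homomorphism. *)
Lemma KummerM (b : k) e e' : b != 0 ->
  Kummer rt b (e * e')%g = (Kummer rt b e * Kummer rt b e')%g.
Proof.
move=> b0; have bN := rtN b0; have r0 := expn_alg_neq0 b0 bN.
apply: val_inj; apply: (fmorph_inj (in_alg L)).
rewrite FinRing.val_unitM rmorphM /= !(Kummer_root _ b0 bN).
rewrite galM ?memvf // -{1}(mulfVK r0 (e (rt b))) rmorphM /=.
by rewrite -(Kummer_root e b0 bN) gal_alg mulrA.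
Qed.

Lemma Kummer4M (d : Ggrp k) e e' :
  Kummer4 rt d (e * e')%g = (Kummer4 rt d e * Kummer4 rt d e')%g.
Proof.
apply/ffunP => i; rewrite !ffunE KummerM // -unitfE; exact: (valP (d i)).
Qed.

Lemma pisig_morph x s : {morph pisig rt x s : u v / (u * v)%g}.
Proof.
move=> [g e] [g' e']; rewrite /pisig /=; congr (_, _).
rewrite gstarM Kummer4M; move: (Kummer4 _ _ e) (Kummer4 _ _ e') => a a'.
move: (gstar g _) (gstar g' _) => b b'; apply: gval_inj; apply/ffunP => i.
by rewrite !gvalM !ffunE; ring.
Qed.

(** By finiteness injectivity is enough: the second component determines the Kummer factor, which
    then cancels. *)
Lemma pisig_bij x s : bijective (pisig rt x s).
Proof.
apply: injF_bij => -[g e] [g' e'] E; have /= Ee := congr1 snd E.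
have := congr1 fst E; rewrite /= Ee => /mulgI/(@gstar_Qmx_inj k s) -> //.
Qed.

Local Notation rho x s := (qdiv (rtd rt (xsig x s)) (star (rtd rt x) (Qmx s))).

Lemma rho_expn x s j : nondeg x ->
  rho x s j ^+ Nq k = (gval (dsig x s) j)%:A.
Proof.
move=> gx; have gxs := nondeg_xsig s gx; have ud := dvec_unit gx.
rewrite gval_dsig // [qdiv (rtd _ _) _ _]ffunE [qdiv (dvec _) _ _]ffunE.
rewrite expr_div_n star_expn rtd_expn //.
have -> : [ffun i => rtd rt x i ^+ Nq k] = qmap (in_alg L) (dvec x).
  by apply/ffunP => i; rewrite [LHS]ffunE rtd_expn // [RHS]ffunE.
rewrite star_qmap //.
by rewrite -!/(in_alg L _) -fmorphV -rmorphM.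
Qed.

(** The constant is an N-th root of [dsig x s j], possibly another one than [rt] chooses, which is
    why [Kummer_root] is stated for an arbitrary root. *)
Lemma gal_rho x s j e : nondeg x ->
  e (rho x s j) = (val (Kummer4 rt (dsig x s) e j))%:A * rho x s j.
Proof.
move=> gx; have d0 : val (dsig x s j) != 0.
  by rewrite -unitfE; apply: (valP (dsig x s j)).
have rN : rho x s j ^+ Nq k = (val (dsig x s j))%:A.
  by rewrite rho_expn // [gval _ _]ffunE.
rewrite [Kummer4 _ _ _ _]ffunE (Kummer_root _ d0 rN) mulfVK //.
exact: expn_alg_neq0 d0 rN.
Qed.

(** The Galois element changes only the structure map, hence only the constants, where [gal_rho]
    produces the Kummer factor; the scaling by [g] passes through the monomial map as
    [gstar g (Qmx s)]. *)
Lemma hsigL_actL (R : comUnitRingType) (phi : {rmorphism L -> R}) x s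
    (P : quad R) (ge : Ggrp k * gal_of {:L}) : nondeg x -> tuple_unit P ->
  hsigL rt x s (actL ge (P, phi : L -> R)) =
  actL (pisig rt x s ge) (hsigL rt x s (P, phi : L -> R)).
Proof.
case: ge => g e gx uP; rewrite /hsigL /actL /=; congr (_, _).
have ugP : tuple_unit (scale (alg_struct phi) g P).
  by rewrite scale_qmul; apply: qmul_unit => //; apply/qmap_unit/gval_unit.
rewrite (hsig_qdiv rtN (phi \o e)) // hsig_qdiv //.
rewrite -[kstruct phi]/(alg_struct phi : k -> R) star_scale // scaleM.
apply/ffunP => j; rewrite ffunE [qmap _ _ _]ffunE [scale _ _ _ _]ffunE.
rewrite /= gal_rho // rmorphM.
rewrite [RHS]ffunE [scale _ _ _ j in RHS]ffunE [qmul _ _ j in RHS]ffunE.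
rewrite [qmap _ _ _ in RHS]ffunE /=; ring.
Qed.

End Equivariance.

Lemma card_fset_set_bij (T U : choiceType) (A : set T) (B : set U)
    (f : T -> U) : set_bij A B f -> #|` fset_set A| = #|` fset_set B|.
Proof.
case=> fAB f_inj f_surj; have EB : B = f @` A.
  by rewrite eqEsubset; split=> // _ [y Ay <-]; apply: fAB.
have cAB : (B #= A)%card by rewrite EB; apply: inj_card_eq.
have [fA|nfA] := pselect (finite_set A).
  by apply/esym/fcard_eq => //; rewrite (eq_finite_set cAB).
have nfB : ~ finite_set B by rewrite (eq_finite_set cAB).
(* On an infinite set [fset_set] defaults to the empty set, so both cardinals are 0. *)
by rewrite /fset_set; do 2!case: pselect => //.
Qed.

(** * Point counts twisted by characters *)

Section Counting.

Variables (k : finFieldType) (L : splittingFieldType k) (rt : k -> L).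
Hypothesis rtN : forall a : k, a != 0 -> rt a ^+ Nq k = a%:A.
Variables (K : fieldType) (phi : {rmorphism L -> K}) (x : 'M[k]_2) (s : 'S_4).
Hypothesis gx : nondeg x.

Local Notation frob := (qmap (fun y : K => y ^+ #|k|)).
Local Notation act := (scale (kstruct phi)).

(** Frobenius multiplies each constant by its N-th power, which is the entry of [dsig x s]. Both
    sides thus acquire the same factor [c], and cancelling it and inverting [Qmx s] leaves the
    condition on [P]. *)
Lemma frob_hsig (g : Ggrp k) (P : quad K) : tuple_unit P ->
  frob (hsig rt phi x s P) = act (dsig x s * gstar g (Qmx s))%g
    (hsig rt phi x s P) <-> frob P = act g P.
Proof.
move=> uP; have q_gt0 : (0 < #|k|)%N by apply/card_gt0P; exists 0.
have ugP : tuple_unit (scale (alg_struct phi) g P).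
  by rewrite scale_qmul; apply: qmul_unit => //; apply/qmap_unit/gval_unit.
have ufP : tuple_unit (frob P) by move=> i; rewrite ffunE unitrX.
set r := qdiv (rtd rt (xsig x s)) (star (rtd rt x) (Qmx s)).
pose c : quad K := qmul (qmap phi r) (qmap (alg_struct phi) (gval (dsig x s))).
have uc : tuple_unit c.
  apply: qmul_unit; last exact/qmap_unit/gval_unit.
  apply: qmap_unit => i; rewrite ffunE unitrM unitrV.
  by apply/andP; split; [apply/rtd_unit/nondeg_xsig|apply/star_unit/rtd_unit].
have -> : frob (hsig rt phi x s P) = qmul c (star (frob P) (Qmx s)).
  rewrite hsig_qdiv // -/r; apply/ffunP => j.
  rewrite [RHS]ffunE [c j]ffunE ffunE [qmul _ _ _]ffunE exprMn star_expn.
  (* Here q is written as N + 1, splitting off one copy of the constant. *)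
  congr (_ * _); rewrite [qmap _ r _]ffunE -{1}(prednK q_gt0) exprS.
  congr (_ * _).
  by rewrite -rmorphXn rho_expn // [RHS]ffunE.
have -> : act (dsig x s * gstar g (Qmx s))%g (hsig rt phi x s P) =
    qmul c (star (scale (alg_struct phi) g P) (Qmx s)).
  rewrite hsig_qdiv // -/r star_scale // -[kstruct phi]/(alg_struct phi : k -> K).
  rewrite scaleM !scale_qmul; apply/ffunP => j.
  rewrite [RHS]ffunE [c j]ffunE [LHS]ffunE ![qmul _ _ j]ffunE; ring.
split=> [/(congr1 (qmul (qinv c))) | ->] //; rewrite !qmulVK //.
by move/(congr1 (fun u => star u (Qmx s^-1))); rewrite !star_QmxK.
Qed.

(** The sum for [xsig x s] is reindexed by a bijection of G matching the Frobenius conditions; the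
    character splits off its value at [dsig x s], and [hsig] matches the counted sets term by
    term. *)
Lemma Nchi_hsig (chi : chars k) : (forall i, chi i \is a linear_char) ->
  chi_eval chi (dsig x s) *
    Nchi (X2 (kstruct phi) (lam x)) frob act (chi_eval (star chi (Qmx s)^T)) =
  Nchi (X2 (kstruct phi) (lam (xsig x s))) frob act (chi_eval chi).
Proof.
move=> chiL; rewrite /Nchi mulrCA; congr (_ * _); rewrite mulr_sumr.
rewrite [RHS](@reindex_inj _ _ _ _
  (fun g => dsig x s * gstar g (Qmx s))%g); last first.
  by move=> g h /mulgI/gstar_Qmx_inj.
apply: eq_bigr => g _; rewrite chi_evalM // -chi_eval_star // mulrA.
congr (_ * _%:R); apply: (@card_fset_set_bij _ _ _ _ (hsig rt phi x s)).
have [h_fun h_inj h_surj] := hsig_bij rtN phi s gx.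
split=> [P /= [XP fP] | P Q | Q [/h_surj[P XP <-] fP]].
- by split; [apply: h_fun | apply/frob_hsig => //; apply: X2L_unit XP].
- by rewrite !inE => -[XP _] [XQ _]; apply: h_inj; rewrite inE.
- have uP : tuple_unit P by apply: X2L_unit XP.
  by exists P => //; split=> //; apply/(frob_hsig _ uP).
Qed.

End Counting.

Theorem theorem5p9
    (k : finFieldType) (L : splittingFieldType k)
    (dimL : \dim {:L} = Nq k)
    (kbar : closedFieldType) (iota : {rmorphism L -> kbar})
    (kbar_alg : integralRange iota)
    (rt : k -> L)
    (rtN : forall a : k, a != 0 -> rt a ^+ Nq k = a%:A)
    (rt1 : rt 1 = 1)
    (x : 'M[k]_2) (x_GL : x \in unitmx)
    (x_neq0 : forall i j, x i j != 0)
    (s : 'S_4)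
    (tau : kbar) (tauN : tau ^+ Nq k = iota (lam x)%:A) :
  exists2 t : L, iota t = tau &
  [/\
   (* (i) *)
   [/\ forall (R : comUnitRingType) (phi : {rmorphism L -> R}),
         [/\ set_bij (X2tau phi (lam x) t) (Xproj phi x) (varphi rt phi x),
             set_bij (X2tau phi (lam (xsig x s)) (tausig rt x t s))
                     (Xproj phi (xsig x s)) (varphi rt phi (xsig x s))
           & set_bij (Xproj phi x) (Xproj phi (xsig x s)) (gsig s)],
       forall (R : comUnitRingType) (phi : {rmorphism L -> R}) (P : quad R),
         X2tau phi (lam x) t P ->
         hsigtau rt phi x t s P =
           qmul (qmap phi (rtd rt (xsig x s)))
                (star (qmul (qinv (qmap phi (rtd rt x))) P) (Qmx s)) /\
         hsigtau rt phi x t s P =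
           qmul (qmap phi (qdiv (rtd rt (xsig x s)) (star (rtd rt x) (Qmx s))))
                (star P (Qmx s)),
       Liso (fun R phi => X2tau phi (lam x) t)
            (fun R phi => X2tau phi (lam (xsig x s)) (tausig rt x t s))
            (fun R phi => hsigtau rt phi x t s)
     & Liso (fun R phi => X2L phi (lam x))
            (fun R phi => X2L phi (lam (xsig x s)))
            (fun R phi => hsig rt phi x s)],
   (* (ii): the composite permutation j |-> s (s' j) is written s' * s *)
   forall s' : 'S_4,
     [/\ lam (xsig (xsig x s) s') = lam (xsig x (s' * s)%g),
         tausig rt (xsig x s) (tausig rt x t s) s' = tausig rt x t (s' * s)%g
       & forall (R : comUnitRingType) (phi : {rmorphism L -> R}) (P : quad R),
         X2tau phi (lam x) t P ->
         hsigtau rt phi (xsig x s) (tausig rt x t s) s'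
           (hsigtau rt phi x t s P) =
         hsigtau rt phi x t (s' * s)%g P],
   (* (iii) *)
   [/\ forall i, val (dsig x s i) =
                 qdiv (dvec (xsig x s)) (star (dvec x) (Qmx s)) i,
       {morph pisig rt x s : u v / (u * v)%g},
       bijective (pisig rt x s)
     & forall (R : comUnitRingType) (phi : {rmorphism L -> R}) (P : quad R)
              (g : Ggrp k) (e : gal_of {:L}),
         X2L phi (lam x) P ->
         hsigL rt x s (actL (g, e) (P, phi : L -> R)) =
         actL (pisig rt x s (g, e)) (hsigL rt x s (P, phi : L -> R))]
   (* (iv) *)
   & forall chi : chars k, (forall i, chi i \is a linear_char) ->
     let frob := qmap (fun y : kbar => y ^+ #|k|) in
     let act := scale (kstruct iota) in
     chi_eval chi (dsig x s) *
       Nchi (X2 (kstruct iota) (lam x)) frob act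
            (chi_eval (star chi (Qmx s)^T)) =
     Nchi (X2 (kstruct iota) (lam (xsig x s))) frob act (chi_eval chi)].
Proof.
have gx : nondeg x by [].
have lam_n0 : lam x != 0 by rewrite !mulf_neq0 // invr_eq0 mulf_neq0.
have [t Et tN] : exists2 t : L, iota t = tau & t ^+ Nq k = (lam x)%:A.
  have r0 : iota (rt (lam x)) != 0.
    by rewrite fmorph_eq0; apply: expn_alg_neq0 (rtN _ lam_n0).
  (* The quotient of [tau] by the chosen root of [lam x] is an N-th root of unity, so it comes from
     [k] and [tau] comes from [L]. *)
  have [|c _ Ec] := @root_unity_range k _ (alg_struct iota) (tau / iota (rt (lam x))).
    by rewrite expr_div_n -rmorphXn rtN // tauN divff // fmorph_eq0 alg_neq0.
  exists (c%:A * rt (lam x)).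
    by rewrite rmorphM -[iota _]/(alg_struct iota c) -Ec mulfVK.
  apply: (fmorph_inj iota); rewrite -tauN rmorphXn; congr (_ ^+ _).
  by rewrite rmorphM -[iota _]/(alg_struct iota c) -Ec mulfVK.
have gxs := nondeg_xsig s gx; have tsN := tausig_expn rtN s gx tN.
exists t => //; split.
- split.
  + move=> R phi.
    by split; [apply: varphi_bij | apply: varphi_bij | apply: gsig_bij].
  + move=> R phi P XP; rewrite hsigtauE // -/(hsig rt phi x s P); split=> //.
    by apply: hsig_qdiv => //; apply: X2L_unit XP.1.
  + split=> [R phi | R S phi u P XP].
      (* Bijectivity is transported from [hsig], which agrees with [hsigtau] on the component. *)
      apply: eq_set_bijLR (hsig_tau_bij rtN phi t s gx) => P /set_mem XP.
      exact: hsigtauE.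
    have XuP := X2tau_qmap u XP.
    rewrite (hsigtauE (phi := u \o phi) rtN) ?hsigtauE //.
    by apply: hsig_natural => //; apply: X2L_unit XP.1.
  + split=> [R phi | R S phi u P XP]; first exact: hsig_bij.
    by apply: hsig_natural => //; apply: X2L_unit XP.
- move=> s'; rewrite xsigM // tausigM //; split=> // R phi P XP.
  (* The image must be known to lie in the component labelled by [tausig] before the second map can
     be replaced by its formula. *)
  have XsP := hsig_X2tau rtN s gx XP.
  rewrite (hsigtauE rtN _ gx tN XP) !hsigtauE // hsigM //.
  by apply: X2L_unit XP.1.
- split; [|exact: pisig_morph|exact: pisig_bij|].
  + by move=> i; rewrite -gval_dsig // [RHS]ffunE.
  + by move=> R phi P g e XP; apply: hsigL_actL => //; apply: X2L_unit XP.
- by move=> chi chiL; apply: (Nchi_hsig rtN iota s gx chiL).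
Qed.
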